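(* Assume there exists a set $T$ of fail-cover hyper-nodes satisfying: 1. $|\tilde D_{T,e}|\ge f_{T,0}$ for all $e\in F$ (i.e. $f_{T,1}\ge f_{T,0}$); 2. $F\subseteq\bigcup_{U\in T}E_U$. Then, for the output $\hat F$ of the Failed Link Detection algorithm with threshold $\eta$: (a) a failed link $e\in F$ is detected ($e\in\hat F$) if $$f_{T,g}+(\eta-1)\big(|\tilde D_{T,e}|-f_{T,0}\big)<0;$$ (b) an operational link $e'\in E_1:=E_H\setminus F$ is not detected as failed ($e'\notin\hat F$) if $$f_{T,g}-\eta\big(f_{T,1}+|\tilde D_{T,e'}|\big)<0\ \text{ in case } e'\notin S_T,\qquad f_{T,g}-\eta\big(f_{T,1}-|\tilde D_{T,e'}|\big)<0\ \text{ in case } e'\in S_T.$$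
   Context: Let $G=(V,E)$ be a finite connected simple undirected graph (the power grid); each link $(s,t)\in E$ has a reactance $r_{st}=r_{ts}\neq 0$. The admittance matrix $B=(b_{uv})_{u,v\in V}$ of $G$ has $b_{uv}=-1/r_{uv}$ if $u\ne v$ and $(u,v)\in E$, $b_{uv}=0$ if $u\neq v$ and $(u,v)\notin E$, and $b_{uu}=-\sum_{w\in V\setminus\{u\}}b_{uw}$. Before the attack, the phase angles $\theta\in\mathbb R^V$ and active power injections $p\in\mathbb R^V$ satisfy $B\theta=p$. The attacked area $H=(V_H,E_H)$ is the subgraph of $G$ induced by $V_H\subseteq V$; the attack disconnects a nonempty set $F\subseteq E_H$ of links. After the attack, $\theta',p'\in\mathbb R^V$ satisfy $B'\theta'=p'$, where $B'$ is the admittance matrix of $(V,E\setminus F)$ with the same reactances. Put $\Delta^*:=p-p'$ (ground-truth change of injections). Standing assumptions: $\theta'_s\neq\theta'_t$ for every $(s,t)\in E_H$; and for every $v\in V_H$, $0\le\Delta^*_v\le p_v$ if $p_v>0$ and $p_v\le\Delta^*_v\le 0$ if $p_v\le 0$. For $u\in V_H$ and $e\in E_H$, let $\tilde D_{u,e}:=(\theta'_u-\theta'_v)/r_{uv}$ if $e=(u,v)$ is incident to $u$, and $\tilde D_{u,e}:=0$ otherwise. Failed Link Detection algorithm with threshold $\eta\in(0,1)$: take an optimal solution $(x,\delta)$, $x\in\mathbb R^{E_H}$, $\delta\in\mathbb R^{V_H}$, of the linear program: minimize $\sum_{e\in E_H}x_e$ subject to $\delta_v=(B(\theta-\theta'))_v+\sum_{e\in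 E_H}\tilde D_{v,e}x_e$ for all $v\in V_H$; $0\le\delta_v\le p_v$ for $v\in V_H$ with $p_v>0$; $p_v\le\delta_v\le0$ for $v\in V_H$ with $p_v\le0$; $0\le x_e\le1$ for all $e\in E_H$. Return $\hat F:=\{e\in E_H: x_e\ge\eta\}$. For $u\in V_H$: if $p_u\le 0$, $g_{D,u}:=-\Delta^*_u$ and $g_{D,-u}:=-p'_u$; if $p_u>0$, $g_{D,u}:=p'_u$ and $g_{D,-u}:=\Delta^*_u$. A hyper-node is a set $U\subseteq V_H$ of nodes that induces a connected subgraph before the attack. $E_U$ is the set of links in $E_H$ with exactly one endpoint in $U$. $\tilde D_{U,e}:=\sum_{u\in U}\tilde D_{u,e}$. A hyper-node $U$ is a fail-cover hyper-node if $E_U\cap F\neq\emptyset$ and $\tilde D_{U,e}\tilde D_{U,l}>0$ for all $e,l\in E_U\cap F$. For a fail-cover hyper-node $U$: $f_{U,1}:=\min_{e\in E_U\cap F}|\tilde D_{U,e}|$; $f_{U,g}:=\sum_{u\in U}g_{D,u}$ if there is $l\in E_U\cap F$ with $\tilde D_{U,l}<0$, and $f_{U,g}:=\sum_{u\in U}g_{D,-u}$ otherwise. Given a set $T$ of fail-cover hyper-nodes, $T$ is divided into $T_n$, those $U\in T$ with $\tilde D_{U,e}\le0$ for all $e\in F$, and $T_p$, those $U\in T$ with $\tilde D_{U,e}\ge0$ for all $e\in F$. Define $R_U:=\max_{U'\in T}f_{U',1}/f_{U,1}$ for $U\in T$; for $e\in E_H$, $\tilde D_{T,e}:=\sum_{U\in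 T_n}R_U\tilde D_{U,e}-\sum_{U\in T_p}R_U\tilde D_{U,e}$; $S_T:=\{e'\in E_H\setminus F:\exists e\in F,\ \tilde D_{T,e'}\tilde D_{T,e}>0\}$; $f_{T,0}:=\max_{e'\in S_T}|\tilde D_{T,e'}|$ (with $f_{T,0}:=0$ if $S_T=\emptyset$); $f_{T,1}:=\min_{e\in F}|\tilde D_{T,e}|$; $f_{T,g}:=\sum_{U\in T}R_Uf_{U,g}$. *)

(* Defs.v *)
From HB Require Import structures.
From mathcomp Require Import all_boot all_order all_algebra.
From mathcomp Require Import reals.

Set Implicit Arguments.
Unset Strict Implicit.
Unset Printing Implicit Defensive.

Import Order.TTheory GRing.Theory Num.Theory.
Local Open Scope ring_scope.

(* Maximum and minimum of f over the indices satisfying P; both are 0 when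
   there is no such index. *)
Definition max_over (R : realType) (I : finType) (P : pred I) (f : I -> R) : R :=
  if [pick i | P i] is Some i0 then f [arg max_(i > i0 | P i) f i]%O else 0.

Definition min_over (R : realType) (I : finType) (P : pred I) (f : I -> R) : R :=
  if [pick i | P i] is Some i0 then f [arg min_(i < i0 | P i) f i]%O else 0.

(* A link between s and t is the unordered pair [set s; t]. *)
Definition links (V : finType) (adj : rel V) : {set {set V}} :=
  [set e : {set V} | [exists s, exists t, adj s t && (e == [set s; t])]].

Definition adm_off (R : realType) (V : finType) (adj : rel V)
    (r : V -> V -> R) (u v : V) : R :=
  if adj u v then - (1 / r u v) else 0.

Definition admittance (R : realType) (V : finType) (adj : rel V)
    (r : V -> V -> R) (u v : V) : R :=
  if u == v then - \sum_(w | w != u) adm_off adj r u w else adm_off adj r u v.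

(* Matrix-vector product, for matrices and vectors indexed by V. *)
Definition app (R : realType) (V : finType) (B : V -> V -> R) (x : V -> R)
    (u : V) : R := \sum_v B u v * x v.

(* Bare data of a grid before (theta, p) and after (theta', p') an attack on
   the subgraph induced by VH; no property of the data is imposed here. *)
Record attack (R : realType) (V : finType) := Attack {
  adj : rel V;
  react : V -> V -> R;
  theta : V -> R;
  p : V -> R;
  VH : {set V};
  F : {set {set V}};
  theta' : V -> R;
  p' : V -> R
}.

Definition adj' (R : realType) (V : finType) (A : attack R V) : rel V :=
  fun u v => adj A u v && ([set u; v] \notin F A).

Definition Bmx (R : realType) (V : finType) (A : attack R V) : V -> V -> R :=
  admittance (adj A) (react A).

Definition Bmx' (R : realType) (V : finType) (A : attack R V) : V -> V -> R :=
  admittance (adj' A) (react A).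

Definition EH (R : realType) (V : finType) (A : attack R V) : {set {set V}} :=
  [set e in links (adj A) | e \subset VH A].

Definition Delta (R : realType) (V : finType) (A : attack R V) (v : V) : R :=
  p A v - p' A v.

(* For a link e incident to u, the picked v is the other endpoint of e, which
   is unique because e has two elements. *)
Definition Dt (R : realType) (V : finType) (A : attack R V) (u : V)
    (e : {set V}) : R :=
  if [pick v | e == [set u; v]] is Some v
  then (theta' A u - theta' A v) / react A u v else 0.

(* The variables x and delta range over total functions; only the values of x
   on EH A and of delta on VH A are ever constrained or used. *)
Definition feasible (R : realType) (V : finType) (A : attack R V)
    (x : {set V} -> R) (delta : V -> R) : Prop :=
  [/\ forall v, v \in VH A ->
        delta v = app (Bmx A) (fun w => theta A w - theta' A w) v
                  + \sum_(e in EH A) Dt A v e * x e,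
      forall v, v \in VH A -> 0 < p A v -> 0 <= delta v <= p A v,
      forall v, v \in VH A -> p A v <= 0 -> p A v <= delta v <= 0
    & forall e, e \in EH A -> 0 <= x e <= 1].

Definition optimal (R : realType) (V : finType) (A : attack R V)
    (x : {set V} -> R) (delta : V -> R) : Prop :=
  feasible A x delta /\
  forall y gamma, feasible A y gamma ->
    \sum_(e in EH A) x e <= \sum_(e in EH A) y e.

Definition Fhat (R : realType) (V : finType) (A : attack R V) (eta : R)
    (x : {set V} -> R) : {set {set V}} :=
  [set e in EH A | eta <= x e].

(* gD A u is g_{D,u} and gDm A u is g_{D,-u}. *)
Definition gD (R : realType) (V : finType) (A : attack R V) (u : V) : R :=
  if 0 < p A u then p' A u else - Delta A u.

Definition gDm (R : realType) (V : finType) (A : attack R V) (u : V) : R :=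
  if 0 < p A u then Delta A u else - p' A u.

Definition hyper_node (R : realType) (V : finType) (A : attack R V)
    (U : {set V}) : bool :=
  [&& U != set0, U \subset VH A &
      [forall u in U, forall v in U,
        connect [rel a b | [&& a \in U, b \in U & adj A a b]] u v]].

Definition EU (R : realType) (V : finType) (A : attack R V) (U : {set V}) :
    {set {set V}} :=
  [set e in EH A | #|e :&: U| == 1%N].

Definition DU (R : realType) (V : finType) (A : attack R V) (U e : {set V}) : R :=
  \sum_(u in U) Dt A u e.

Definition fail_cover (R : realType) (V : finType) (A : attack R V)
    (U : {set V}) : bool :=
  [&& hyper_node A U, EU A U :&: F A != set0 &
      [forall e in EU A U :&: F A, forall l in EU A U :&: F A,
        0 < DU A U e * DU A U l]].

Definition fU1 (R : realType) (V : finType) (A : attack R V) (U : {set V}) : R :=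
  min_over (fun e => e \in EU A U :&: F A) (fun e => `|DU A U e|).

Definition fUg (R : realType) (V : finType) (A : attack R V) (U : {set V}) : R :=
  if [exists l in EU A U :&: F A, DU A U l < 0]
  then \sum_(u in U) gD A u else \sum_(u in U) gDm A u.

Definition Tn (R : realType) (V : finType) (A : attack R V) (T : {set {set V}}) :
    {set {set V}} :=
  [set U in T | [forall e in F A, DU A U e <= 0]].

Definition Tp (R : realType) (V : finType) (A : attack R V) (T : {set {set V}}) :
    {set {set V}} :=
  [set U in T | [forall e in F A, 0 <= DU A U e]].

Definition RU (R : realType) (V : finType) (A : attack R V) (T : {set {set V}})
    (U : {set V}) : R :=
  max_over (fun U' => U' \in T) (fun U' => fU1 A U' / fU1 A U).

Definition DT (R : realType) (V : finType) (A : attack R V) (T : {set {set V}})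
    (e : {set V}) : R :=
  \sum_(U in Tn A T) RU A T U * DU A U e - \sum_(U in Tp A T) RU A T U * DU A U e.

Definition ST (R : realType) (V : finType) (A : attack R V) (T : {set {set V}}) :
    {set {set V}} :=
  [set e' in EH A :\: F A | [exists e in F A, 0 < DT A T e' * DT A T e]].

Definition fT0 (R : realType) (V : finType) (A : attack R V) (T : {set {set V}}) : R :=
  max_over (fun e' => e' \in ST A T) (fun e' => `|DT A T e'|).

Definition fT1 (R : realType) (V : finType) (A : attack R V) (T : {set {set V}}) : R :=
  min_over (fun e => e \in F A) (fun e => `|DT A T e|).

Definition fTg (R : realType) (V : finType) (A : attack R V) (T : {set {set V}}) : R :=
  \sum_(U in T) RU A T U * fUg A U.

(* Main.v *)
Require Import Defs.
From mathcomp Require Import all_boot all_order all_algebra.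
From mathcomp Require Import reals.
From mathcomp Require Import ring lra.

Import Order.TTheory GRing.Theory Num.Theory.
Local Open Scope ring_scope.

(** The indicator of F together with the true change of injections is feasible,
    so an optimal x satisfies [sum_e z_e <= 0] for [z = x - 1_F], and z is
    nonpositive on F, nonnegative off F.  Summing the equality constraints over
    a hyper-node, and then over T with the weights R_U (signed so that every
    contribution on F is nonpositive), gives [sum_e DT_e z_e <= fTg].  Adding
    [c * sum_e z_e <= 0] for a constant c between fT0 and fT1 makes every
    summand [(DT_e + c) z_e] nonnegative, hence each one is at most fTg.
    Taking c = fT0 at a failed link gives (a); taking c = fT1 at an operational
    link gives (b). *)

(** * Extrema over finite index sets and a termwise bound *)

Lemma max_over_ge {R : realType} {I : finType} {P : pred I} (f : I -> R) i :
  P i -> f i <= max_over P f.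
Proof.
move=> Pi; rewrite /max_over; case: pickP => [j Pj | /(_ i)]; last by rewrite Pi.
by case: arg_maxP => // k _; apply.
Qed.

Lemma max_over_ge0 {R : realType} {I : finType} (P : pred I) (f : I -> R) :
  (forall i, 0 <= f i) -> 0 <= max_over P f.
Proof. by move=> f_ge0; rewrite /max_over; case: pickP. Qed.

Lemma min_over_le {R : realType} {I : finType} {P : pred I} (f : I -> R) i :
  P i -> min_over P f <= f i.
Proof.
move=> Pi; rewrite /min_over; case: pickP => [j Pj | /(_ i)]; last by rewrite Pi.
by case: arg_minP => // k _; apply.
Qed.

Lemma min_over_attained {R : realType} {I : finType} {P : pred I} (f : I -> R) i :
  P i -> exists2 j, P j & min_over P f = f j.
Proof.
move=> Pi; rewrite /min_over; case: pickP => [j Pj | /(_ i)]; last by rewrite Pi.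
by case: arg_minP => // k Pk _; exists k.
Qed.

Lemma shifted_term_le {R : realType} {I : finType} {E : {set I}}
    {D z : I -> R} {c g : R} :
  0 <= c -> \sum_(e in E) D e * z e <= g -> \sum_(e in E) z e <= 0 ->
  (forall e, e \in E -> 0 <= (D e + c) * z e) ->
  forall e, e \in E -> (D e + c) * z e <= g.
Proof.
move=> c_ge0 leg z_le0 term_ge0 e Ee.
have : \sum_(i in E) (D i + c) * z i <= g.
  rewrite (eq_bigr _ (fun i _ => mulrDl (D i) c (z i))) big_split /= -mulr_sumr.
  have : c * \sum_(i in E) z i <= 0 by rewrite mulr_ge0_le0.
  by lra.
apply: le_trans; rewrite (bigD1 e) //= lerDl sumr_ge0 // => i /andP[Ei _].
exact: term_ge0.
Qed.

(** * Links, line flows and the admittance matrix *)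

Lemma set2_inj {V : finType} (u v w : V) :
  v != u -> w != u -> [set u; v] = [set u; w] -> v = w.
Proof.
move=> vu _ /setP/(_ v); rewrite !inE eqxx orbT (negbTE vu) /=.
by move/esym/eqP.
Qed.

Lemma EHP {R : realType} {V : finType} {A : attack R V} {e : {set V}} :
  irreflexive (adj A) -> e \in EH A ->
  exists s t, [/\ adj A s t, s != t & e = [set s; t]].
Proof.
move=> irr; rewrite !inE => /andP[/existsP[s /existsP[t /andP[st /eqP ->]]] _].
exists s, t; split=> //; apply/eqP => eq_st.
by move: st; rewrite eq_st irr.
Qed.

Lemma Dt_set2 {R : realType} {V : finType} (A : attack R V) (s t : V) :
  t != s -> Dt A s [set s; t] = (theta' A s - theta' A t) / react A s t.
Proof.
move=> ts; rewrite /Dt; case: pickP => [v /eqP /esym eq_v | /(_ t)]; last first.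
  by rewrite eqxx.
suff -> : v = t by [].
(* The picked [v] lies in [[set s; t]]; if it were [s], the pair would collapse and force
   [t = s]. *)
have /setP/(_ v) := eq_v; rewrite !inE eqxx orbT => /esym/orP[/eqP vs | /eqP //].
have /setP/(_ t) := eq_v; rewrite !inE eqxx orbT vs orbb => /eqP ts'.
by rewrite ts' eqxx in ts.
Qed.

Lemma Dt_notin {R : realType} {V : finType} (A : attack R V) (u : V) (e : {set V}) :
  u \notin e -> Dt A u e = 0.
Proof.
rewrite /Dt; case: pickP => // v /eqP ->.
by rewrite !inE eqxx.
Qed.

(** The diagonal entry is minus the sum of its row, so only differences of angles along incident
    links survive. Stated for an arbitrary relation so as to serve both before and after the
    attack. *)
Lemma app_admittance {R : realType} {V : finType} (a : rel V) r (y : V -> R) u :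
  irreflexive a ->
  app (admittance a r) y u = \sum_(w | a u w) (y u - y w) / r u w.
Proof.
move=> irr; rewrite /app (bigD1 u) //= /admittance eqxx mulNr mulr_suml.
rewrite [X in _ + X](eq_bigr (fun w => adm_off a r u w * y w)) => [|w wu].
  2: by rewrite eq_sym (negbTE wu).
rewrite -sumrN -big_split /= [RHS]big_mkcond [RHS](bigD1 u) //= irr add0r.
apply: eq_bigr => w wu; rewrite /adm_off.
by case: (a u w); rewrite ?mul0r ?oppr0 ?add0r //; ring.
Qed.

Lemma app_sub {R : realType} {V : finType} (B : V -> V -> R) (y z : V -> R) u :
  app B (fun w => y w - z w) u = app B y u - app B z u.
Proof. by rewrite /app -sumrB; apply: eq_bigr => w _; rewrite mulrBr. Qed.

(** Failed links through [u] correspond bijectively to the neighbours they join to [u]; failed links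
    missing [u] contribute zero. *)
Lemma sum_Dt_links {R : realType} {V : finType} (A : attack R V) (u : V) :
  symmetric (adj A) -> irreflexive (adj A) -> F A \subset EH A ->
  \sum_(e in F A) Dt A u e =
  \sum_(w | adj A u w && ([set u; w] \in F A))
     (theta' A u - theta' A w) / react A u w.
Proof.
move=> sym irr /subsetP FE.
have adj_neq w : adj A u w -> w != u.
  by move=> uw; apply/eqP => wu; move: uw; rewrite wu irr.
rewrite (bigID (fun e : {set V} => u \in e)) /= [X in _ + X]big1 ?addr0; last first.
  by move=> e /andP[_ /Dt_notin].
pose N := [set w | adj A u w && ([set u; w] \in F A)].
transitivity (\sum_(e in [set [set u; w] | w in N]) Dt A u e).
  apply: eq_bigl => e; apply/andP/imsetP => [[Fe ue] | [w]]; last first.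
    by rewrite inE => /andP[_ Fe] ->; rewrite Fe !inE eqxx.
  have [s [t [st _ def_e]]] := EHP irr (FE _ Fe).
  move: ue; rewrite def_e !inE => /orP[] /eqP eq_u.
    by exists t; rewrite ?inE eq_u // st -def_e Fe.
  by exists s; rewrite ?inE eq_u; rewrite setUC // sym st -def_e Fe.
rewrite big_imset /=; last first.
  move=> v w; rewrite !inE => /andP[/adj_neq vu _] /andP[/adj_neq wu _].
  exact: set2_inj.
rewrite big_set; apply: eq_bigr => w /andP[/adj_neq wu _].
exact: Dt_set2.
Qed.

(** Applied to [theta'], the two admittance matrices differ exactly by the would-be flows on the
    failed links. This is the equality constraint satisfied by the true failure. *)
Lemma app_Bmx_diff {R : realType} {V : finType} (A : attack R V) :
  symmetric (adj A) -> irreflexive (adj A) -> F A \subset EH A ->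
  (forall u, app (Bmx A) (theta A) u = p A u) ->
  (forall u, app (Bmx' A) (theta' A) u = p' A u) ->
  forall u, app (Bmx A) (fun w => theta A w - theta' A w) u
            = Delta A u - \sum_(e in F A) Dt A u e.
Proof.
move=> sym irr FE flow flow' u.
have irr' : irreflexive (adj' A) by move=> w; rewrite /adj' irr.
rewrite app_sub flow /Delta -flow' /Bmx /Bmx' !app_admittance // sum_Dt_links //.
rewrite (bigID (fun w => [set u; w] \in F A)) /= /adj'.
by ring.
Qed.

(** * Signs and weights of fail-cover hyper-nodes *)

(** A link with both ends in [U] carries opposite flows at its ends, which cancel because the
    reactance is symmetric; a link with no end in [U] has only zero terms. *)
Lemma DU_notin_EU {R : realType} {V : finType} (A : attack R V) (U e : {set V}) :
  symmetric (adj A) -> irreflexive (adj A) ->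
  (forall s t, adj A s t -> react A s t = react A t s) ->
  e \in EH A -> e \notin EU A U -> DU A U e = 0.
Proof.
move=> sym irr react_sym Ee; rewrite inE Ee /=.
have [s [t [st neq_st ->]]] := EHP irr Ee => card_neq1.
rewrite /DU (bigID (mem [set s; t])) /= [X in _ + X]big1 ?addr0; last first.
  by move=> u /andP[_ /Dt_notin].
have eq_st : (s \in U) = (t \in U).
  (* If exactly one endpoint were in [U], the intersection would be the singleton of that
     endpoint. *)
  apply: contraNeq card_neq1; case sU: (s \in U); case tU: (t \in U) => // _.
    apply/cards1P; exists s; apply/setP => w; rewrite !inE.
    case: (eqVneq w s) => [->|_] /=; first by rewrite sU.
    by case: (eqVneq w t) => [->|].
  apply/cards1P; exists t; apply/setP => w; rewrite !inE.
  case: (eqVneq w t) => [->|_] /=; first by rewrite tU orbT.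
  by rewrite orbF; case: (eqVneq w s) => [->|].
case tU: (t \in U) in eq_st; last first.
  rewrite big1 // => u /andP[uU]; rewrite !inE => /orP[] /eqP eq_u;
    by rewrite eq_u ?eq_st ?tU in uU.
rewrite (eq_bigl (mem [set s; t])) => [|u]; last first.
  rewrite !inE; case: (eqVneq u s) => [->|_]; first by rewrite eq_st.
  by case: (eqVneq u t) => [->|]; rewrite ?tU ?andbF.
rewrite big_setU1 ?inE //= big_set1 Dt_set2 1?eq_sym // setUC Dt_set2 //.
by rewrite (react_sym s t st); ring.
Qed.

(** On failed links crossing the boundary of [U] the sign is constant, and on the others [DU]
    vanishes. The strict witness later keeps [U] out of the opposite class of [T]. *)
Lemma fail_cover_sign {R : realType} {V : finType} (A : attack R V) (U : {set V}) :
  symmetric (adj A) -> irreflexive (adj A) ->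
  (forall s t, adj A s t -> react A s t = react A t s) ->
  F A \subset EH A -> fail_cover A U ->
  (forall e, e \in F A -> DU A U e <= 0)
    /\ (exists2 l, l \in EU A U :&: F A & DU A U l < 0)
  \/ (forall e, e \in F A -> 0 <= DU A U e)
    /\ (exists2 l, l \in EU A U :&: F A & 0 < DU A U l).
Proof.
move=> sym irr react_sym /subsetP FE /and3P[_ /set0Pn[l EFl] /forall_inP same].
have sameE e : e \in EU A U :&: F A -> 0 < DU A U l * DU A U e.
  by move=> EFe; have /forall_inP := same l EFl; apply.
have case_F e : e \in F A -> DU A U e = 0 \/ 0 < DU A U l * DU A U e.
  move=> Fe; case Ue: (e \in EU A U); first by right; apply: sameE; rewrite inE Ue.
  by left; apply: DU_notin_EU; rewrite ?FE ?Ue.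
case: (ltrgt0P (DU A U l)) => l_sgn; last first.
- by have := sameE l EFl; rewrite l_sgn mul0r ltxx.
- left; split; last by exists l.
  by move=> e /case_F[-> // | ]; rewrite nmulr_rgt0 // => /ltW.
- right; split; last by exists l.
  by move=> e /case_F[-> // | ]; rewrite pmulr_rgt0 // => /ltW.
Qed.

Lemma fU1_gt0 {R : realType} {V : finType} (A : attack R V) (U : {set V}) :
  fail_cover A U -> 0 < fU1 A U.
Proof.
case/and3P=> _ /set0Pn[l EFl] /forall_inP same.
have [j EFj] := min_over_attained (P := fun e => e \in EU A U :&: F A)
  (fun e => `|DU A U e|) l EFl.
rewrite -/(fU1 A U) => ->.
have /forall_inP/(_ j EFj) := same j EFj.
by rewrite normr_gt0; apply: contraTneq => ->; rewrite mul0r ltxx.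
Qed.

(** [U] itself competes in the maximum with ratio 1, its [fU1] being positive. *)
Lemma RU_ge1 {R : realType} {V : finType} (A : attack R V) (T : {set {set V}}) U :
  fail_cover A U -> U \in T -> 1 <= RU A T U.
Proof.
move=> /fU1_gt0 fU_gt0 TU.
have := max_over_ge (P := fun U' => U' \in T) (fun U' => fU1 A U' / fU1 A U) U TU.
by rewrite divff ?gt_eqF.
Qed.

(** * Feasibility, optimality and the weighted combination over [T] *)

(** The competitor is the indicator of [F] paired with [Delta]; [app_Bmx_diff] is its equality
    constraint. *)
Lemma optimal_excess {R : realType} {V : finType} (A : attack R V) x delta :
  symmetric (adj A) -> irreflexive (adj A) -> F A \subset EH A ->
  (forall u, app (Bmx A) (theta A) u = p A u) ->
  (forall u, app (Bmx' A) (theta' A) u = p' A u) ->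
  (forall v, v \in VH A -> 0 < p A v -> 0 <= Delta A v <= p A v) ->
  (forall v, v \in VH A -> p A v <= 0 -> p A v <= Delta A v <= 0) ->
  optimal A x delta ->
  \sum_(e in EH A) (x e - (e \in F A)%:R) <= 0.
Proof.
move=> sym irr FE flow flow' Dpos Dneg [_ opt].
rewrite sumrB subr_le0; apply: (opt _ (Delta A)); split=> // [v _ | e _].
  rewrite app_Bmx_diff // [X in _ + X](big_setID (F A)) /= (setIidPr FE).
  rewrite [X in _ + (_ + X)]big1 => [|e]; last first.
    by rewrite inE => /andP[/negbTE -> _]; rewrite mulr0.
  rewrite [X in _ + (X + _)](eq_bigr (Dt A v)) => [|e ->]; last by rewrite mulr1.
  by rewrite addr0 subrK.
by case: (e \in F A); rewrite /= ?lexx ?ler01.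
Qed.

(** Subtracting the constraints of the true failure from those of [x] leaves the sum of
    [delta u - Delta A u]. The box constraints on [delta] bound each term: for positive [p] it lies
    between [- Delta] and [p'], otherwise between [p'] and [- Delta]. *)
Lemma sum_hyper_node_bounds {R : realType} {V : finType} (A : attack R V) x delta
    (U : {set V}) :
  symmetric (adj A) -> irreflexive (adj A) -> F A \subset EH A ->
  (forall u, app (Bmx A) (theta A) u = p A u) ->
  (forall u, app (Bmx' A) (theta' A) u = p' A u) ->
  feasible A x delta -> U \subset VH A ->
  - \sum_(u in U) gDm A u
    <= \sum_(e in EH A) DU A U e * (x e - (e \in F A)%:R)
    <= \sum_(u in U) gD A u.
Proof.
move=> sym irr FE flow flow' [delta_eq delta_pos delta_neg _] /subsetP UV.
have -> : \sum_(e in EH A) DU A U e * (x e - (e \in F A)%:R)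
    = \sum_(u in U) (delta u - Delta A u).
  rewrite (eq_bigr _ (fun e _ => mulr_suml _ _ _ _)) exchange_big /=.
  apply: eq_bigr => u uU; rewrite delta_eq ?UV // app_Bmx_diff //.
  rewrite (eq_bigr _ (fun e _ => mulrBr _ _ _)) sumrB.
  rewrite [X in _ - X = _](big_setID (F A)) /= (setIidPr FE).
  rewrite [X in _ - (_ + X) = _]big1 => [|e]; last first.
    by rewrite inE => /andP[/negbTE -> _]; rewrite mulr0.
  rewrite [X in _ - (X + _) = _](eq_bigr (Dt A u)) => [|e ->]; last by rewrite mulr1.
  by ring.
have bounds u : u \in U -> - gDm A u <= delta u - Delta A u <= gD A u.
  move=> /UV uV; rewrite /gD /gDm; case: ltP => p_sgn.
    by have := delta_pos u uV p_sgn; rewrite /Delta; lra.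
  by have := delta_neg u uV p_sgn; rewrite /Delta; lra.
by rewrite -sumrN; apply/andP; split; apply: ler_sum => u /bounds/andP[].
Qed.

Lemma sum_DT_le_fTg {R : realType} {V : finType} (A : attack R V) x delta
    (T : {set {set V}}) :
  symmetric (adj A) -> irreflexive (adj A) ->
  (forall s t, adj A s t -> react A s t = react A t s) ->
  F A \subset EH A ->
  (forall u, app (Bmx A) (theta A) u = p A u) ->
  (forall u, app (Bmx' A) (theta' A) u = p' A u) ->
  feasible A x delta -> (forall U, U \in T -> fail_cover A U) ->
  \sum_(e in EH A) DT A T e * (x e - (e \in F A)%:R) <= fTg A T.
Proof.
move=> sym irr react_sym FE flow flow' feas cover.
pose z e : R := x e - (e \in F A)%:R.
(* A signed coefficient merges the two classes into one sum over [T], so that the sums over links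
   and hyper-nodes can be exchanged. *)
have DTE e : DT A T e = \sum_(U in T)
    ((U \in Tn A T)%:R - (U \in Tp A T)%:R) * RU A T U * DU A U e.
  rewrite /DT [X in X - _]big_mkcond [X in _ - X]big_mkcond -sumrB [RHS]big_mkcond /=.
  apply: eq_bigr => U _; rewrite !inE.
  case: (U \in T) => /=; last by rewrite subrr.
  by do 2!case: [forall e, _] => /=; ring.
under eq_bigr => e _ do rewrite DTE mulr_suml.
rewrite exchange_big; apply: ler_sum => U TU /=.
have -> : \sum_(e in EH A) ((U \in Tn A T)%:R - (U \in Tp A T)%:R) * RU A T U
      * DU A U e * z e
    = RU A T U * (((U \in Tn A T)%:R - (U \in Tp A T)%:R)
      * \sum_(e in EH A) DU A U e * z e).
  rewrite mulrA mulr_sumr; apply: eq_bigr => e _; ring.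
rewrite ler_wpM2l ?(le_trans ler01) ?RU_ge1 ?cover //.
have /and3P[/and3P[_ UV _] _ _] := cover U TU.
have /andP[lo hi] := sum_hyper_node_bounds _ _ _ _ sym irr FE flow flow' feas UV.
(* Each [U] lies in exactly one class: in [Tn] the upper bound [hi] applies, in [Tp] the lower bound
   [lo] after negation, matching the two branches of [fUg]. *)
have [[sgn [l EFl l_sgn]] | [sgn [l EFl l_sgn]]] :=
  fail_cover_sign _ _ sym irr react_sym FE (cover U TU).
  have -> : U \in Tn A T by rewrite inE TU; apply/forall_inP.
  have -> : (U \in Tp A T) = false.
    rewrite inE TU; apply/forall_inP => /(_ l).
    by move: EFl; rewrite inE => /andP[_ ->] /(_ isT); lra.
  rewrite /fUg ifT; last by apply/exists_inP; exists l.
  by rewrite subr0 mul1r.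
have -> : U \in Tp A T by rewrite inE TU; apply/forall_inP.
have -> : (U \in Tn A T) = false.
  rewrite inE TU; apply/forall_inP => /(_ l).
  by move: EFl; rewrite inE => /andP[_ ->] /(_ isT); lra.
rewrite /fUg ifF; first by rewrite sub0r mulN1r lerNl.
by apply/exists_inP => -[k]; rewrite inE => /andP[_ /sgn]; lra.
Qed.

(** Every hyper-node contributes a nonpositive term on [F], and one whose boundary contains [e]
    contributes a strictly negative one. *)
Lemma DT_F_lt0 {R : realType} {V : finType} (A : attack R V) (T : {set {set V}}) :
  symmetric (adj A) -> irreflexive (adj A) ->
  (forall s t, adj A s t -> react A s t = react A t s) ->
  F A \subset EH A -> (forall U, U \in T -> fail_cover A U) ->
  F A \subset \bigcup_(U in T) EU A U ->
  forall e, e \in F A -> DT A T e < 0.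
Proof.
move=> sym irr react_sym FE cover /subsetP cov e Fe.
have RU_gt0 U : U \in T -> 0 < RU A T U.
  by move=> TU; rewrite (lt_le_trans ltr01) ?RU_ge1 ?cover.
have Tn_le0 U : U \in Tn A T -> RU A T U * DU A U e <= 0.
  rewrite inE => /andP[TU /forall_inP/(_ e Fe)].
  by rewrite pmulr_rle0 ?RU_gt0.
have Tp_ge0 U : U \in Tp A T -> 0 <= RU A T U * DU A U e.
  rewrite inE => /andP[TU /forall_inP/(_ e Fe)].
  by rewrite pmulr_rge0 ?RU_gt0.
have sum_n : \sum_(U in Tn A T) RU A T U * DU A U e <= 0 by apply: sumr_le0.
have sum_p : 0 <= \sum_(U in Tp A T) RU A T U * DU A U e by apply: sumr_ge0.
have /bigcupP[U TU Ue] := cov e Fe.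
have EFe : e \in EU A U :&: F A by rewrite inE Ue.
have DU_neq0 : DU A U e != 0.
  (* The sign condition with both links equal to [e] makes the square of [DU A U e] positive. *)
  have /and3P[_ _ /forall_inP/(_ e EFe)/forall_inP/(_ e EFe)] := cover U TU.
  by apply: contraTneq => ->; rewrite mul0r ltxx.
have [[sgn _] | [sgn _]] := fail_cover_sign _ _ sym irr react_sym FE (cover U TU).
  have UTn : U \in Tn A T by rewrite inE TU; apply/forall_inP.
  have U_lt0 : RU A T U * DU A U e < 0.
    by rewrite pmulr_rlt0 ?RU_gt0 // lt_neqAle DU_neq0 sgn.
  have rest : \sum_(W in Tn A T | W != U) RU A T W * DU A W e <= 0.
    by apply: sumr_le0 => W /andP[/Tn_le0].
  by rewrite /DT (bigD1 U) //=; lra.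
have UTp : U \in Tp A T by rewrite inE TU; apply/forall_inP.
have U_gt0 : 0 < RU A T U * DU A U e.
  by rewrite pmulr_rgt0 ?RU_gt0 // lt_neqAle eq_sym DU_neq0 sgn.
have rest : 0 <= \sum_(W in Tp A T | W != U) RU A T W * DU A W e.
  by apply: sumr_ge0 => W /andP[/Tp_ge0].
by rewrite /DT [X in _ - X](bigD1 U) //=; lra.
Qed.

(** * Detection guarantees from the termwise bound *)

Theorem theoremV3 (R : realType) (V : finType) (A : attack R V)
  (adj_sym : symmetric (adj A))
  (adj_irr : irreflexive (adj A))
  (adj_conn : forall u v, connect (adj A) u v)
  (react_sym : forall s t, adj A s t -> react A s t = react A t s)
  (react_neq0 : forall s t, adj A s t -> react A s t != 0)
  (F_neq0 : F A != set0)
  (F_sub : F A \subset EH A)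
  (flow : forall u, app (Bmx A) (theta A) u = p A u)
  (flow' : forall u, app (Bmx' A) (theta' A) u = p' A u)
  (theta'_neq : forall s t, [set s; t] \in EH A -> theta' A s != theta' A t)
  (Delta_pos : forall v, v \in VH A -> 0 < p A v -> 0 <= Delta A v <= p A v)
  (Delta_neg : forall v, v \in VH A -> p A v <= 0 -> p A v <= Delta A v <= 0)
  (eta : R) (eta_bounds : 0 < eta < 1)
  (x : {set V} -> R) (delta : V -> R) (x_opt : optimal A x delta)
  (T : {set {set V}})
  (T_fail_cover : forall U, U \in T -> fail_cover A U)
  (T_dom : forall e, e \in F A -> fT0 A T <= `|DT A T e|)
  (T_cover : F A \subset \bigcup_(U in T) EU A U) :
  [/\ forall e, e \in F A ->
        fTg A T + (eta - 1) * (`|DT A T e| - fT0 A T) < 0 ->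
        e \in Fhat A eta x,
      forall e', e' \in EH A :\: F A -> e' \notin ST A T ->
        fTg A T - eta * (fT1 A T + `|DT A T e'|) < 0 ->
        e' \notin Fhat A eta x
    & forall e', e' \in EH A :\: F A -> e' \in ST A T ->
        fTg A T - eta * (fT1 A T - `|DT A T e'|) < 0 ->
        e' \notin Fhat A eta x].
Proof.
have /andP[eta_gt0 eta_lt1] := eta_bounds.
have feas := x_opt.1; have [_ _ _ x01] := feas.
have FE := subsetP F_sub.
have DF_lt0 := DT_F_lt0 A T adj_sym adj_irr react_sym F_sub T_fail_cover T_cover.
have DF_abs e : e \in F A -> `|DT A T e| = - DT A T e.
  by move=> /DF_lt0 D_lt0; rewrite ltr0_norm.
have [e0 Fe0] := set0Pn _ F_neq0.
(* Since [DT] is negative on all of the nonempty [F], sharing a sign with some failed link just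
   means being negative. *)
have ST_lt0 e : e \in EH A :\: F A -> (e \in ST A T) = (DT A T e < 0).
  move=> E1e; rewrite inE E1e /=; apply/exists_inP/idP => [[k /DF_lt0 k_lt0] | e_lt0].
    by rewrite nmulr_lgt0.
  by exists e0; rewrite // nmulr_lgt0 // DF_lt0.
have f0_ge0 : 0 <= fT0 A T by apply: max_over_ge0.
have [k Fk f1_eq] := min_over_attained (P := fun e => e \in F A)
  (fun e => `|DT A T e|) e0 Fe0.
have f0_le_f1 : fT0 A T <= fT1 A T by rewrite /fT1 f1_eq T_dom.
(* A negative value puts [e] in [ST], where [fT0] bounds it; otherwise [fT0 >= 0] suffices,
   including the default 0 for empty [ST]. *)
have D_ge e : e \in EH A :\: F A -> - fT0 A T <= DT A T e.
  move=> E1e; case: (ltP (DT A T e) 0) => [D_lt0 | ]; last by lra.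
  have STe : e \in ST A T by rewrite ST_lt0.
  have := max_over_ge (P := fun e => e \in ST A T) (fun e => `|DT A T e|) e STe.
  by rewrite -/(fT0 A T) ltr0_norm //; lra.
have term_le c : fT0 A T <= c -> (forall e, e \in F A -> c <= `|DT A T e|) ->
    forall e, e \in EH A -> (DT A T e + c) * (x e - (e \in F A)%:R) <= fTg A T.
  move=> f0c cF.
  apply: shifted_term_le.
  - exact: le_trans f0_ge0 f0c.
  - exact: sum_DT_le_fTg feas T_fail_cover.
  - exact: optimal_excess x_opt.
  move=> e Ee; have /andP[x_ge0 x_le1] := x01 e Ee.
  case: (boolP (e \in F A)) => Fe /=.
    have := cF e Fe; rewrite DF_abs // => cD.
    (* Both factors are nonpositive on [F]: [c <= - DT] and [x e <= 1]. *)
    by rewrite mulr_le0 //; lra.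
  have E1e : e \in EH A :\: F A by rewrite inE Fe.
  by have := D_ge e E1e => De; rewrite mulr_ge0 //; lra.
have f1_le e : e \in F A -> fT1 A T <= `|DT A T e|.
  exact: (min_over_le (P := fun e => e \in F A) (fun e => `|DT A T e|)).
have detected_le e : e \in EH A -> e \in Fhat A eta x -> 0 <= DT A T e + fT1 A T ->
    e \notin F A -> (DT A T e + fT1 A T) * eta <= fTg A T.
  move=> Ee; rewrite inE Ee /= => x_ge D_ge0 /negbTE nFe.
  have := term_le (fT1 A T) f0_le_f1 f1_le e Ee; rewrite nFe subr0.
  by apply: le_trans; rewrite ler_wpM2l.
split=> [e Fe | e E1e STe | e E1e STe].
- apply: contraTT; rewrite inE FE //= -ltNge -leNgt => x_lt.
  have := term_le (fT0 A T) (lexx _) T_dom e (FE e Fe).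
  have := T_dom e Fe; rewrite Fe DF_abs //= => f0_le Dx_le.
  (* This product replaces [x e] by [eta] in [Dx_le], giving [(1 - eta) * (- DT A T e - fT0 A T) <=
     fTg A T]. *)
  have : 0 <= (- DT A T e - fT0 A T) * (eta - x e) by rewrite mulr_ge0 //; lra.
  by lra.
- have D_ge0 : 0 <= DT A T e by rewrite leNgt -ST_lt0.
  apply: contraTN => hat_e; rewrite -leNgt ger0_norm //.
  move: E1e; rewrite inE => /andP[nFe Ee].
  have D_f1 : 0 <= DT A T e + fT1 A T by lra.
  by have := detected_le e Ee hat_e D_f1 nFe; lra.
- have D_lt0 : DT A T e < 0 by rewrite -ST_lt0.
  (* Here [DT >= - fT0 >= - fT1], so the shifted coefficient stays nonnegative although [DT] is
     negative. *)
  have De := D_ge e E1e.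
  apply: contraTN => hat_e; rewrite -leNgt ltr0_norm //.
  move: E1e; rewrite inE => /andP[nFe Ee].
  have D_f1 : 0 <= DT A T e + fT1 A T by lra.
  by have := detected_le e Ee hat_e D_f1 nFe; lra.
Qed.
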